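(* Let $Q$ be a precoherent near multiplicative lattice such that every compact element of $Q$ is residuated and $x\wedge1$ exists for all $x\in Q$, and let $\star$ be a nucleus on $Q$. For any $x\in Q$ let $x^{\overline{\star}}=\bigvee\{x/z:\ z\in\star\text{-}\mathrm{GV}(Q)\}$. Then $\overline{\star}$ is the coarsest stable nucleus on $Q$ that is finer than $\star$. Moreover, the following conditions on $\star$ are equivalent. (1) $\star$ is stable. (2) $(x\wedge1)^\star=x^\star\wedge1^\star$ and $(x/t)^\star=x^\star/t$ for all $x,t\in Q$ with $t$ compact. (3) $(x/t\wedge1)^\star=x^\star/t\wedge1^\star$ for all $x,t\in Q$ with $t$ compact. (4) $\star=\overline{\star}$.
   Context: A near multiplicative lattice is a commutative monoid $Q$ with a partial order compatible with multiplication such that every nonempty subset $X$ of $Q$ has a supremum and $a\bigvee X=\bigvee(aX)$ for all $a\in Q$. A directed subset of a poset is a nonempty subset in which every finite subset has an upper bound. An element $x$ is compact if whenever $x\le\bigvee\Delta$ for a directed $\Delta$ whose supremum exists, one has $x\le y$ for some $y\in\Delta$. $Q$ is precoherent if every element is a supremum of a set of compact elements and the set of compact elements is closed under multiplication. For $x,y\in Q$, $x/y$ denotes the largest $z\in Q$ with $zy\le x$ (if it exists), and $y\backslash x$ the largest $z$ with $yz\le x$ (these coincide here by commutativity). In a near multiplicative lattice, $x/y$ exists whenever some $z$ satisfies $zy\le x$ (near residuated). An element $a$ is residuated if $x/a$ and $a\backslash x$ exist for all $x\in Q$. A closure operation is an expansive, order-preserving, idempotent self-map; a nucleus is a closure operation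 $\star$ with $x^\star y^\star\le(xy)^\star$ for all $x,y$ (where $x^\star=\star(x)$). A nucleus $\star$ is stable if $(\bigwedge X)^\star=\bigwedge\{x^\star:x\in X\}$ for every finite subset $X$ such that $\bigwedge X$ exists, and $(x/t)^\star=x^\star/t$ (resp., $(t\backslash x)^\star=t\backslash x^\star$) for all $x,t$ with $t$ compact such that $x/t$ (resp., $t\backslash x$) exists. $\star\text{-}\mathrm{GV}(Q)=\{z\in Q: z\le1\text{ and }z^\star=1^\star\}$; $x/z$ exists for all $z\le1$. If $x^{\star_1}\le x^{\star_2}$ for all $x$, then $\star_1$ is finer than $\star_2$ and $\star_2$ is coarser than $\star_1$. *)

(* Defs.v *)
From HB Require Import structures.
From mathcomp Require Import all_boot all_order.
From mathcomp Require Import boolp classical_sets cardinality.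

Set Implicit Arguments.
Unset Strict Implicit.
Unset Printing Implicit Defensive.

Import Order.TTheory.
Local Open Scope classical_set_scope.

(* In classical_sets, [supremums X] (resp. [infimums X]) is the set of all
   suprema (resp. infima) of X, so [supremums X s] reads "s is the supremum of
   X" and [supremums X !=set0] reads "the supremum of X exists". *)
HB.mixin Record isNearMultLattice (d : Order.disp_t) Q
    of Monoid Q & Order.POrder d Q := {
  nml_mulC : forall x y : Q, (x * y = y * x)%g;
  nml_le_mul : forall a x y : Q, (x <= y)%O -> (a * x <= a * y)%O%g;
  nml_sup_ex : forall X : set Q, X !=set0 -> supremums X !=set0;
  nml_mul_sup : forall (a : Q) (X : set Q) (s : Q),
    X !=set0 -> supremums X s -> supremums [set (a * x)%g | x in X] (a * s)%g
}.

#[short(type="nearMultLatticeType")]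
HB.structure Definition NearMultLattice (d : Order.disp_t) :=
  {Q of isNearMultLattice d Q & Monoid Q & Order.POrder d Q}.

Section Poset.
Variables (d : Order.disp_t) (T : porderType d).
Implicit Types (x y : T) (X D : set T).

Definition directed D : Prop :=
  D !=set0 /\
  forall F : set T, finite_set F -> F `<=` D -> exists2 u, D u & ubound F u.

Definition compact_elt x : Prop :=
  forall D s, directed D -> supremums D s -> (x <= s)%O ->
    exists2 y, D y & (x <= y)%O.

(* The value is the infimum of x and y only when the latter exists. *)
Definition wedge x y : T := infimum x [set x; y].

Definition finer (s1 s2 : T -> T) : Prop := forall x, (s1 x <= s2 x)%O.

Definition closure_operation (star : T -> T) : Prop :=
  [/\ forall x, (x <= star x)%O,
      {homo star : x y / (x <= y)%O} &
      forall x, star (star x) = star x].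

Lemma wedgeP x y :
  infimums [set x; y] !=set0 -> infimums [set x; y] (wedge x y).
Proof.
rewrite /wedge /infimum => -[m hm]; case: ifPn => [/eqP e|_].
  by have : [set x; y] x by [left]; rewrite e.
exact: (xgetI x hm).
Qed.

End Poset.

Section NearMultLatticeTheory.
Variables (d : Order.disp_t) (Q : nearMultLatticeType d).
Implicit Types (x y z a t r : Q) (star : Q -> Q).

Definition precoherent : Prop :=
  (forall x, exists2 K : set Q, K `<=` @compact_elt d Q & supremums K x) /\
  (forall x y, compact_elt x -> compact_elt y -> compact_elt (x * y)%g).

(* [rquots x y r] reads "x/y exists and equals r"; [lquots y x r] reads
   "y\x exists and equals r". *)
Definition rquots x y : set Q :=
  [set r | (r * y <= x)%O%g /\ forall z, (z * y <= x)%O%g -> (z <= r)%O].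

Definition lquots y x : set Q :=
  [set r | (y * r <= x)%O%g /\ forall z, (y * z <= x)%O%g -> (z <= r)%O].

(* x/y, with the irrelevant value 1 when x/y does not exist. *)
Definition rquot x y : Q := xget 1%g (rquots x y).

Definition residuated a : Prop :=
  forall x, rquots x a !=set0 /\ lquots a x !=set0.

Definition nucleus star : Prop :=
  closure_operation star /\
  forall x y, (star x * star y <= star (x * y))%O%g.

(* Each equation is stated as "if the quantity on the left exists, then the one
   on the right exists and is its image". *)
Definition stable_nucleus star : Prop :=
  [/\ nucleus star,
      forall (X : set Q) (m : Q), finite_set X ->
        infimums X m -> infimums [set star x | x in X] (star m),
      forall x t r, compact_elt t ->
        rquots x t r -> rquots (star x) t (star r) &
      forall x t r, compact_elt t ->
        lquots t x r -> lquots t (star x) (star r)].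

Definition GV star : set Q :=
  [set z | (z <= 1%g)%O /\ star z = star 1%g].

Definition bar star x : Q := supremum 1%g [set rquot x z | z in GV star].

Lemma rquotP x y : rquots x y !=set0 -> rquots x y (rquot x y).
Proof. by case=> r hr; exact: (xgetI 1%g hr). Qed.

Lemma near_residuated x y :
  (exists z, (z * y <= x)%O%g) -> rquots x y !=set0.
Proof.
case=> z hz; have ne : [set u : Q | (u * y <= x)%O%g] !=set0 by exists z.
have [r hr] := nml_sup_ex _ ne; exists r; split; last first.
  by move=> u hu; case: hr => + _; apply.
rewrite nml_mulC; case: (nml_mul_sup y _ _ ne hr) => _; apply => _ [u hu <-].
by rewrite nml_mulC.
Qed.

Lemma rquot_le1P x z : (z <= 1%g)%O -> rquots x z (rquot x z).
Proof.
move=> z1; apply/rquotP/near_residuated; exists x.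
by rewrite -{2}[x]mulg1; exact: nml_le_mul.
Qed.

Lemma barP star x : supremums [set rquot x z | z in GV star] (bar star x).
Proof.
have ne : [set rquot x z | z in GV star] !=set0.
  by exists (rquot x 1%g); exists 1%g.
rewrite /bar /supremum; case: ifPn => [/eqP e|_]; first by case: ne; rewrite e.
by have [s hs] := nml_sup_ex _ ne; exact: (xgetI 1%g hs).
Qed.

End NearMultLatticeTheory.

(* Main.v *)
Require Import Defs.
From HB Require Import structures.
From mathcomp Require Import all_boot all_order.
From mathcomp Require Import boolp classical_sets cardinality.

Set Implicit Arguments.
Unset Strict Implicit.
Unset Printing Implicit Defensive.

(**
  [GV star] is closed under products, so the family [x/z], [z] in [GV star], is
  directed and a compact [w] lies below [bar star x] iff [w z <= x] for some
  [z] in [GV star].  As every element is a supremum of compacts, each claim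
  about [bar star] reduces to this criterion.  Conversely, if [s] is stable and
  finer than [star] and [w <= s x] is compact, then [z = x/w /\ 1] satisfies
  [s z = s x / w /\ s 1 >= 1]; hence [z] is in [GV star], and [w z <= x] gives
  [w <= bar star x].
*)

Local Open Scope classical_set_scope.

Import Order.TTheory.

(** * Binary infima *)

Section PosetComplements.
Variables (d : Order.disp_t) (T : porderType d).
Implicit Types (x y m : T).

Lemma infimums_wedge x y m : infimums [set x; y] m -> wedge x y = m.
Proof.
move=> hm; apply: (is_subset1_infimums (A := [set x; y])) => //.
by apply: wedgeP; exists m.
Qed.

Lemma wedge_lel x y : infimums [set x; y] !=set0 -> (wedge x y <= x)%O.
Proof. by case/wedgeP => + _; apply; left. Qed.

Lemma wedge_ler x y : infimums [set x; y] !=set0 -> (wedge x y <= y)%O.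
Proof. by case/wedgeP => + _; apply; right. Qed.

Lemma le_wedge x y m : infimums [set x; y] !=set0 ->
  (m <= x)%O -> (m <= y)%O -> (m <= wedge x y)%O.
Proof. by case/wedgeP => _ h mx my; apply: h => _ [->|->]. Qed.

End PosetComplements.

(** * Multiplication, infima and residuals *)

Section NearMultLatticeComplements.
Variables (d : Order.disp_t) (Q : nearMultLatticeType d).
Implicit Types (x y z a t r w : Q) (star s : Q -> Q).

Lemma nml_le_mulr a x y : (x <= y)%O -> (x * a <= y * a)%O%g.
Proof. by move=> xy; rewrite ![(_ * a)%g]nml_mulC; apply: nml_le_mul. Qed.

Lemma nml_le_mul2 x y z w :
  (x <= y)%O -> (z <= w)%O -> (x * z <= y * w)%O%g.
Proof.
by move=> xy zw; apply: le_trans (nml_le_mulr _ xy) (nml_le_mul _ _ _ zw).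
Qed.

Lemma nml_mul_le1 x y : (x <= 1%g)%O -> (y <= 1%g)%O -> (x * y <= 1)%O%g.
Proof. by move=> x1 y1; rewrite -[1%g]mulg1; apply: nml_le_mul2. Qed.

Lemma nml_mul_le1l x y : (x <= 1%g)%O -> (x * y <= y)%O%g.
Proof. by move=> x1; rewrite -[leRHS]mul1g; apply: nml_le_mulr. Qed.

Lemma nml_mul_le1r x y : (y <= 1%g)%O -> (x * y <= x)%O%g.
Proof. by rewrite nml_mulC; apply: nml_mul_le1l. Qed.

(** The infimum is the supremum of the set of lower bounds, which [a] makes nonempty. *)
Lemma nml_inf_ex (X : set Q) a : lbound X a -> infimums X !=set0.
Proof.
move=> aX; have [m [mub mlub]] := nml_sup_ex (lbound X) (ex_intro _ a aX).
exists m; split=> [x Xx|]; last exact: mub.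
by apply: mlub => l; apply.
Qed.

Lemma mul_sup_le (X : set Q) a y m : X !=set0 -> supremums X m ->
  (forall x, X x -> (a * x <= y)%O%g) -> (a * m <= y)%O%g.
Proof.
move=> X0 Xs h; have [_] := nml_mul_sup a X m X0 Xs.
by apply=> _ [x Xx <-]; apply: h.
Qed.

Lemma rquot_eq x y r : rquots x y r -> rquot x y = r.
Proof.
move=> hr; have [h1 h2] := rquotP (ex_intro _ r hr); case: hr => h3 h4.
by apply: le_anti; rewrite h2 // h4.
Qed.

Lemma le_rquot x z w : (z <= 1%g)%O ->
  (w <= rquot x z)%O = (w * z <= x)%O%g.
Proof.
move=> z1; have [h1 h2] := rquot_le1P x z1; apply/idP/idP; last exact: h2.
by move=> h; apply: le_trans h1; apply: nml_le_mulr.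
Qed.

Lemma lquotsE t x : lquots t x = rquots x t.
Proof.
rewrite /lquots /rquots; apply/seteqP; split=> r /=; rewrite nml_mulC => -[h1 h2];
  by split=> // z; rewrite nml_mulC; apply: h2.
Qed.

Lemma precoherent_le x y : precoherent Q ->
  (forall w, compact_elt w -> (w <= x)%O -> (w <= y)%O) -> (x <= y)%O.
Proof.
case=> gen _ h; have [K Kc [Kub Klub]] := gen x.
by apply: Klub => w Kw; apply: h; [apply: Kc|apply: Kub].
Qed.

(** * The elements of [GV star] *)

Section Nucleus.
Variable star : Q -> Q.
Hypothesis nucleus_star : nucleus star.

Let star_ge x : (x <= star x)%O.
Proof. by case: nucleus_star => -[]. Qed.

Let star_homo : {homo star : x y / (x <= y)%O}.
Proof. by case: nucleus_star => -[]. Qed.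

Let star_idem x : star (star x) = star x.
Proof. by case: nucleus_star => -[]. Qed.

Let star_mul x y : (star x * star y <= star (x * y))%O%g.
Proof. by case: nucleus_star. Qed.

Lemma GVE z : GV star z <-> (z <= 1%g)%O /\ (1%g <= star z)%O.
Proof.
split=> -[z1 hz]; split=> //; first by rewrite hz.
apply: le_anti; rewrite star_homo //=.
by rewrite -(star_idem z) star_homo.
Qed.

Lemma GV_le1 z : GV star z -> (z <= 1%g)%O.
Proof. by case. Qed.

Lemma GV1 : GV star 1%g.
Proof. by split. Qed.

(** As [1 <= star z], one has [w <= star w * star z <= star (w * z)]. Thus [star] does not see
    multiplication by [z], which is what puts [bar star] below [star]. *)
Lemma le_star_mulGV w z : GV star z -> (w <= star (w * z))%O%g.
Proof.
move=> /GVE[_ z1]; apply: le_trans (star_mul w z).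
by rewrite -[leLHS]mulg1; apply: nml_le_mul2.
Qed.

Lemma GV_mul z w : GV star z -> GV star w -> GV star (z * w)%g.
Proof.
move=> hz hw; apply/GVE; split; first by apply: nml_mul_le1; apply: GV_le1.
have /GVE[_ z1] := hz; apply: (le_trans z1).
by rewrite -(star_idem (z * w)%g); apply: star_homo; apply: le_star_mulGV.
Qed.

(** The product of the finitely many witnesses works: it stays in [GV star] and lies below each of
    them, because all are at most [1]. *)
Lemma GV_finite_refine (F : set Q) (P : Q -> Q -> Prop) : finite_set F ->
  (forall x z z', (z' <= z)%O -> P x z -> P x z') ->
  (forall x, F x -> exists2 z, GV star z & P x z) ->
  exists2 z, GV star z & forall x, F x -> P x z.
Proof.
move=> /finite_seqP[l ->] Pdown; elim: l => [|a l IH] h.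
  by exists 1%g; [exact: GV1|].
have [|z hz Pz] := IH.
  by move=> x xl; apply: h; rewrite /= inE (xl : x \in l) orbT.
have [|w hw Pw] := h a; first by rewrite /= inE eqxx.
exists (z * w)%g; first exact: GV_mul.
move=> x /=; rewrite inE => /orP[/eqP->|xl].
  by apply: Pdown Pw; apply: nml_mul_le1l; apply: GV_le1.
by apply: Pdown (Pz x xl); apply: nml_mul_le1r; apply: GV_le1.
Qed.

(** * Comparing elements with [bar star x] *)

Lemma directed_rquot_GV x : directed [set rquot x z | z in GV star].
Proof.
split; first by exists (rquot x 1%g); exists 1%g; first exact: GV1.
move=> F finF FD.
(* For [z] in [GV star], the relation [P y z] means [y <= rquot x z], so a common [z] gives an upper
   bound of [F] inside the family. *)
have [y u u' u'u h|y Fy|z hz hF] :=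
    GV_finite_refine (P := fun y z => (y * z <= x)%O%g) finF.
- by apply: le_trans h; apply: nml_le_mul.
- have [z hz <-] := FD y Fy; exists z => //.
  by rewrite -le_rquot //; apply: GV_le1.
- exists (rquot x z); first by exists z.
  by move=> y Fy; rewrite le_rquot; [apply: hF|apply: GV_le1].
Qed.

Lemma le_bar x z w : GV star z -> (w * z <= x)%O%g -> (w <= bar star x)%O.
Proof.
move=> hz h; have [ub _] := barP star x.
apply: (@le_trans _ _ (rquot x z)); first by rewrite le_rquot //; apply: GV_le1.
by apply: ub; exists z.
Qed.

Lemma bar_le x y : (forall w z, GV star z -> (w * z <= x)%O%g -> (w <= y)%O) ->
  (bar star x <= y)%O.
Proof.
move=> h; have [_] := barP star x; apply=> _ [z hz <-].
by apply: (h _ z) => //; rewrite -le_rquot //; apply: GV_le1.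
Qed.

Lemma compact_le_bar x w : compact_elt w -> (w <= bar star x)%O ->
  exists2 z, GV star z & (w * z <= x)%O%g.
Proof.
move=> cw wx.
have [_ [z hz <-] h] := cw _ _ (directed_rquot_GV x) (barP star x) wx.
by exists z => //; rewrite -le_rquot //; apply: GV_le1.
Qed.

(** * [bar star] as a nucleus finer than [star] *)

Lemma bar_finer : finer (bar star) star.
Proof.
move=> x; apply: bar_le => w z hz h.
by apply: le_trans (le_star_mulGV w hz) _; apply: star_homo.
Qed.

Lemma le_bar_id x : (x <= bar star x)%O.
Proof. by apply: (le_bar GV1); rewrite mulg1. Qed.

Lemma bar_homo : {homo bar star : x y / (x <= y)%O}.
Proof.
move=> x y xy; apply: bar_le => w z hz h.
by apply: (le_bar hz); apply: le_trans xy.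
Qed.

(** Multiplication by [a] preserves the nonempty supremum defining [bar star x], so the bound need
    only be tested on the residuals [rquot x z]. *)
Lemma bar_mul_le a x y :
  (forall w z, GV star z -> (w * z <= x)%O%g -> (a * w <= y)%O%g) ->
  (a * bar star x <= y)%O%g.
Proof.
move=> h; apply: (mul_sup_le _ (barP star x)).
  by exists (rquot x 1%g); exists 1%g; first exact: GV1.
move=> _ [z hz <-]; apply: (h _ _ hz).
by rewrite -le_rquot //; apply: GV_le1.
Qed.

Lemma bar_mul x y : (bar star x * bar star y <= bar star (x * y))%O%g.
Proof.
apply: bar_mul_le => w z hz h; rewrite nml_mulC.
apply: bar_mul_le => v u hu k.
apply: (@le_bar _ (u * z)%g); first exact: GV_mul.
(* Regroup as [(v * u) * (w * z)], with [v * u <= x] and [w * z <= y]. *)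
rewrite [(w * v)%g]nml_mulC -mulgA [(w * _)%g]mulgA [(w * u)%g]nml_mulC.
by rewrite -mulgA mulgA; apply: nml_le_mul2.
Qed.

Hypothesis precohQ : precoherent Q.

(* If [w z <= bar star x] with [w] compact and [z] in [GV star], then
   [u = sup {v <= 1 | w v <= x}] is in [GV star]: every compact [c <= z] has
   [w c z' <= x] for some [z'] in [GV star], so [c <= star (c z') <= star u]. *)
Lemma bar_idem x : bar star (bar star x) = bar star x.
Proof.
apply: le_anti; rewrite le_bar_id andbT.
apply: precoherent_le => // w cw wx.
have [z hz wz] := compact_le_bar cw wx.
pose V := [set v | (v <= 1%g)%O /\ (w * v <= x)%O%g].
have cV c : compact_elt c -> (c <= z)%O ->
    exists2 z', GV star z' & V (c * z')%g.
  move=> cc cz; have [|z' hz' h] := @compact_le_bar x _ (precohQ.2 _ _ cw cc).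
    by apply: le_trans wz; apply: nml_le_mul.
  exists z' => //; split; last by rewrite mulgA.
  by apply: nml_mul_le1; [apply: le_trans cz _|]; apply: GV_le1.
(* Only nonempty sets are known to have suprema, so a compact element below [z] must be produced to
   feed [cV]. *)
have V0 : V !=set0.
  have [K Kc [Kub Klub]] := precohQ.1 z.
  have [[c Kc']|K0] := pselect (K !=set0).
    have [z' _ h] := cV c (Kc _ Kc') (Kub _ Kc').
    by exists (c * z')%g.
  (* A supremum of the empty set is a least element, hence compact. *)
  have z_le y : (z <= y)%O by apply: Klub => c Kc'; case: K0; exists c.
  have cz : compact_elt z by move=> D s [[y Dy] _] _ _; exists y.
  by have [z' _ h] := cV z cz (lexx z); exists (z * z')%g.
have [u uV] := nml_sup_ex _ V0.
apply: (@le_bar _ u); last first.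
  by apply: (mul_sup_le V0 uV) => v [].
have u1 : (u <= 1%g)%O by case: uV => _; apply=> v [].
apply/GVE; split=> //.
have /GVE[_ z1] := hz; apply: (le_trans z1); rewrite -(star_idem u).
apply: star_homo; apply: precoherent_le => // c cc cz.
have [z' hz' h] := cV c cc cz.
apply: le_trans (le_star_mulGV c hz') _; apply: star_homo.
by case: uV => + _; apply.
Qed.

Lemma nucleus_bar : nucleus (bar star).
Proof.
split; last exact: bar_mul.
by split; [exact: le_bar_id|exact: bar_homo|exact: bar_idem].
Qed.

(** * Stability of [bar star] *)

Lemma bar_rquots x t r : compact_elt t ->
  rquots x t r -> rquots (bar star x) t (bar star r).
Proof.
move=> ct [rt rmax]; split.
  rewrite nml_mulC; apply: bar_mul_le => w z hz h.
  apply: (le_bar hz); rewrite -mulgA nml_mulC.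
  by apply: le_trans rt; apply: nml_le_mulr.
move=> y yt; apply: precoherent_le => // w cw wy.
(* The product [w * t] is compact and below [bar star x], so some [z] in [GV star] gives
   [w * z * t <= x], that is, [w * z <= r]. *)
have [|z hz h] := @compact_le_bar x _ (precohQ.2 _ _ cw ct).
  by apply: le_trans yt; apply: nml_le_mulr.
apply: (le_bar hz); apply: rmax.
by rewrite -mulgA [(z * t)%g]nml_mulC mulgA.
Qed.

(** A compact [w] below all the images has a witness for each [x] in [X]. Finiteness merges these
    into one [z], and then [w * z] is a lower bound of [X]. *)
Lemma bar_infimums (X : set Q) m : finite_set X -> infimums X m ->
  infimums [set bar star x | x in X] (bar star m).
Proof.
move=> finX [lb glb]; split=> [_ [x Xx <-]|l hl].
  by apply: bar_homo; apply: lb.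
apply: precoherent_le => // w cw wl.
have [x z z' z'z h|x Xx|z hz h] :=
    GV_finite_refine (P := fun x z => (w * z <= x)%O%g) finX.
- by apply: le_trans h; apply: nml_le_mul.
- by apply: compact_le_bar => //; apply: (le_trans wl); apply: hl; exists x.
- by apply: (le_bar hz); apply: glb => x; apply: h.
Qed.

Lemma stable_nucleus_bar : stable_nucleus (bar star).
Proof.
split; [exact: nucleus_bar|exact: bar_infimums|exact: bar_rquots|].
by move=> x t r ct; rewrite !lquotsE; apply: bar_rquots.
Qed.

(** * Comparison of [bar star] with stable nuclei *)

Hypothesis compact_residuated : forall a : Q, compact_elt a -> residuated a.
Hypothesis wedge1_exists : forall x : Q, infimums [set x; 1%g] !=set0.

(** The assumptions on [s] are common to a stable nucleus finer than [star] and to [star] itself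
    under the third equivalent condition; the lemma serves both cases. *)
Lemma finer_bar s : (forall x, x <= s x)%O -> finer s star ->
  (forall x t, compact_elt t ->
     s (wedge (rquot x t) 1%g) = wedge (rquot (s x) t) (s 1%g)) ->
  finer s (bar star).
Proof.
move=> s_ge s_star hs x; apply: precoherent_le => // w cw wx.
have [wQ _] := rquotP (compact_residuated cw x).1.
have [_ sQ] := rquotP (compact_residuated cw (s x)).1.
have ex := wedge1_exists (rquot x w).
have hz := hs x w cw; have := wedge_lel ex; have := wedge_ler ex.
move: (wedge _ 1%g) hz => z hz z1 zQ.
have Q1 : (1%g <= rquot (s x) w)%O by apply: sQ; rewrite mul1g.
have sz1 : (1%g <= s z)%O.
  rewrite hz; apply: le_wedge => //.
  (* Both [rquot (s x) w] and [s 1] are above [1], so their infimum exists and [wedge] is not a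
     default value. *)
  by apply: (@nml_inf_ex _ 1%g) => _ [->|->].
apply: (@le_bar _ z); first by apply/GVE; split=> //; apply: le_trans (s_star z).
by apply: le_trans wQ; rewrite nml_mulC; apply: nml_le_mulr.
Qed.

End Nucleus.

Lemma stable_wedge s x y : stable_nucleus s -> infimums [set x; y] !=set0 ->
  s (wedge x y) = wedge (s x) (s y).
Proof.
case=> _ hinf _ _ /wedgeP hxy; apply/esym/infimums_wedge.
rewrite -[[set s x; s y]](_ : s @` [set x; y] = _).
  exact: hinf (finite_set2 _ _) hxy.
by rewrite image_setU !image_set1.
Qed.

Lemma stable_rquot s x t : stable_nucleus s -> compact_elt t ->
  rquots x t !=set0 -> s (rquot x t) = rquot (s x) t.
Proof. by case=> _ _ hq _ ct /rquotP hr; apply/esym/rquot_eq/hq. Qed.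

End NearMultLatticeComplements.

Theorem theorem11p3 (d : Order.disp_t) (Q : nearMultLatticeType d)
    (precohQ : precoherent Q)
    (compact_residuated : forall a : Q, compact_elt a -> residuated a)
    (wedge1_exists : forall x : Q, infimums [set x; 1%g] !=set0)
    (star : Q -> Q) (nucleus_star : nucleus star) :
  [/\ stable_nucleus (bar star),
      finer (bar star) star &
      forall s : Q -> Q, stable_nucleus s -> finer s star -> finer s (bar star)]
  /\
  [<-> stable_nucleus star;
       (forall x : Q, star (wedge x 1%g) = wedge (star x) (star 1%g)) /\
       (forall x t : Q, compact_elt t ->
          star (rquot x t) = rquot (star x) t);
       (forall x t : Q, compact_elt t ->
          star (wedge (rquot x t) 1%g) =
            wedge (rquot (star x) t) (star 1%g));
       star = bar star].
Proof.
have stable_quot (s : Q -> Q) (hs : stable_nucleus s) x t (ct : compact_elt t) :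
    s (rquot x t) = rquot (s x) t.
  by apply: stable_rquot => //; case: (compact_residuated t ct x).
split.
  split; [exact: stable_nucleus_bar|exact: bar_finer|move=> s hs s_star].
  apply: finer_bar => // [x|x t ct]; first by case: hs => -[[]].
  by rewrite stable_wedge // stable_quot.
tfae.
- by move=> hs; split=> [x|x t ct]; [apply: stable_wedge|apply: stable_quot].
- by move=> [hw hq] x t ct; rewrite hw hq.
- move=> h; apply/funext => x; apply: le_anti; rewrite bar_finer // andbT.
  by apply: finer_bar => // y; case: nucleus_star => -[].
- by move=> ->; apply: stable_nucleus_bar.
Qed.
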